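(* Let $G$ be an $r$-regular finite simple graph on $n$ vertices whose eigenvalues with respect to the Seidel matrix $S(G)$ are $\theta_1(G)\ge\theta_2(G)\ge\cdots\ge\theta_n(G)$. Let $\mathcal{U}=G\cup G'$ be the disjoint union of $G$ and $G'$, where $G'$ is a copy of $G$ with a self-loop attached at each vertex. If $|\theta_i(G)|\ge\frac12$ for $i=2,\ldots,n$, then $$\mathcal{SE}(\mathcal{U})=2\,\mathcal{SE}(G)+2\left(\max\{|\theta_1(G)|,R\}-|\theta_1(G)|\right),\qquad\text{where } R=\sqrt{n^2+\tfrac14}.$$ In particular, if $|\theta_1(G)|\le R$, then $$\mathcal{SE}(\mathcal{U})=2\sqrt{n^2+\tfrac14}+2\sum_{i=2}^n|\theta_i(G)|.$$
   Context: A graph is $r$-regular if all its vertices have degree $r$. The Seidel matrix $S(G)=[s_{ij}]$ of a simple graph $G$ with vertices $v_1,\dots,v_n$ is the real symmetric $n\times n$ matrix with $s_{ii}=0$ for all $i$ and, for $i\ne j$, $s_{ij}=-1$ if $v_i,v_j$ are adjacent and $s_{ij}=1$ if they are non-adjacent. The Seidel energy of $G$ is $\mathcal{SE}(G)=\sum_{i=1}^n|\theta_i(G)|$, where $\theta_1(G),\dots,\theta_n(G)$ are the eigenvalues of $S(G)$ (with multiplicity). For a simple graph $H$ on $N$ vertices and $W\subseteq V(H)$ with $|W|=\sigma$, let $H_W$ be the graph obtained from $H$ by attaching a self-loop at each vertex of $W$. Its Seidel matrix is $S(H_W)=S(H)-\mathfrak{I}_W$, where $\mathfrak{I}_W$ is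 the diagonal $N\times N$ matrix whose diagonal entry is $1$ at vertices of $W$ and $0$ otherwise, and its Seidel energy is $\mathcal{SE}(H_W)=\sum_{i=1}^N\left|\theta_i(H_W)+\frac{\sigma}{N}\right|$, where $\theta_i(H_W)$ are the eigenvalues of $S(H_W)$ (with multiplicity). The graph $\mathcal{U}$ is such a self-loop graph with $N=2n$ vertices and $\sigma=n$ loops, namely one loop at each vertex of the copy $G'$ and none at the vertices of $G$; there are no edges between $G$ and $G'$.
   Formalization: False if θ_1 is the largest eigenvalue (K_3: SE(U)=2R+4, formula gives 2R+6). The formal theorem instead takes θ_1 = n-1-2r, the eigenvalue of the all-ones vector, with θ_2,…,θ_n the other eigenvalues in any order; n ≥ 1. *)

(* Defs.v *)
From HB Require Import structures.
From mathcomp Require Import all_boot all_order all_algebra.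
From mathcomp Require Import polyrcf.

Set Implicit Arguments.
Unset Strict Implicit.
Unset Printing Implicit Defensive.
Import Order.TTheory GRing.Theory Num.Theory.
Local Open Scope ring_scope.

Record sgraph := SGraph {
  vertex :> finType;
  adj : rel vertex;
  adj_sym : symmetric adj;
  adj_irr : irreflexive adj }.

Definition regular (G : sgraph) (r : nat) : Prop :=
  forall v : G, #|[set w | adj v w]| = r.

Record loop_graph := LoopGraph {
  base : sgraph;
  loops : {set base} }.

Section DisjointUnion.
Variables G H : sgraph.

Definition union_adj : rel (G + H)%type := fun x y =>
  match x, y with
  | inl u, inl v => adj u v
  | inr u, inr v => adj u v
  | _, _ => false
  end.

Lemma union_adj_sym : symmetric union_adj.
Proof. by case=> u [] v //=; apply: adj_sym. Qed.

Lemma union_adj_irr : irreflexive union_adj.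
Proof. by case=> u /=; apply: adj_irr. Qed.

Definition disjoint_union : sgraph := SGraph union_adj_sym union_adj_irr.

End DisjointUnion.

Definition union_looped_copy (G : sgraph) : loop_graph :=
  @LoopGraph (disjoint_union G G) [set inr v | v : G].

Section Seidel.
Variable R : rcfType.

(* Rows and columns follow the enumeration [enum_val] of the vertices. *)
Definition seidel (G : sgraph) : 'M[R]_#|G| :=
  \matrix_(i, j)
    if i == j then 0 else if adj (enum_val i) (enum_val j) then -1 else 1.

Definition loop_seidel (H : loop_graph) : 'M[R]_#|base H| :=
  seidel (base H) - diag_mx (\row_i (enum_val i \in loops H)%:R).

(* The eigenvalues in R, each repeated according to its multiplicity as a root *)
(* of the characteristic polynomial; for a real symmetric matrix these are all *)
(* the eigenvalues, and geometric and algebraic multiplicities agree.          *)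
Definition eigenvalues n (A : 'M[R]_n) : seq R :=
  flatten [seq nseq (mup x (char_poly A)) x | x <- rootsR (char_poly A)].

Lemma eigenvalues_split n (A : 'M[R]_n) (s : seq R) :
  char_poly A = \prod_(x <- s) ('X - x%:P) -> perm_eq (eigenvalues A) s.
Proof.
move=> As; have A0 : char_poly A != 0 by rewrite monic_neq0 ?char_poly_monic.
apply/allP => x _ /=; apply/eqP.
rewrite /eigenvalues count_flatten -map_comp sumnE big_map.
under eq_bigr => y _ do rewrite /= count_nseq /=.
have us : uniq (rootsR (char_poly A)) by apply: uniq_roots.
have [xr|xr] := boolP (x \in rootsR (char_poly A)).
  rewrite (bigD1_seq x) //= eqxx mul1n big1 ?addn0 => [|y /negPf -> //].
  by rewrite As mu_prod_XsubC.
rewrite big_seq big1 => [|y yr]; last first.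
  by case: eqP => // yx; rewrite -yx yr in xr.
apply/esym/count_memPn; move: xr.
have /(_ x) := roots_on_rootsR A0; rewrite in_itv /= => <-.
by rewrite As root_prod_XsubC.
Qed.

Definition seidel_energy (G : sgraph) : R :=
  \sum_(x <- eigenvalues (seidel G)) `|x|.

Definition loop_seidel_energy (H : loop_graph) : R :=
  \sum_(x <- eigenvalues (loop_seidel H))
    `|x + #|loops H|%:R / #|base H|%:R|.

End Seidel.

(* Main.v *)
(** For the all-ones matrix J, the Seidel matrix of the union is the block
    matrix [[S, J], [J, S - I]], and J commutes with S because G is regular:
    SJ = JS = tJ with t = theta_1. Commuting blocks give
    det ((x - S)(x + 1 - S) - nJ) as characteristic polynomial. Multiplying
    this matrix by the scalar q = (x - t)(x - t + 1) factors it as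
    (x - S)(x + 1 - S)(q - nJ), and q - nJ is a rank one update of a scalar
    matrix. So the eigenvalues of the union are theta_i and theta_i - 1 for
    i >= 2 together with the roots t - 1/2 +- rho of q - n^2. After the shift
    by 1/2, the pair theta_i +- 1/2 contributes 2 |theta_i| since
    |theta_i| >= 1/2, and the pair t +- rho contributes 2 max (|t|, rho). *)

Require Import Defs.
From mathcomp Require Import all_boot all_order all_algebra.
From mathcomp Require Import perm polyrcf ring lra.
Import Order.TTheory GRing.Theory Num.Theory.
Local Open Scope ring_scope.

(** * Eigenvalues with multiplicity and the characteristic polynomial *)

Lemma dvdp_prod_mup (F : fieldType) (p : {poly F}) (s : seq F) :
  p != 0 -> uniq s -> \prod_(x <- s) ('X - x%:P) ^+ mup x p %| p.
Proof.
move=> p0; elim: s => [|a s IHs] /=; first by rewrite big_nil dvd1p.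
case/andP=> a_s us; rewrite big_cons Gauss_dvdp ?IHs ?andbT //.
  by rewrite -mup_geq.
apply: coprimep_expl; rewrite coprimep_sym coprimep_XsubC rootE horner_prod.
rewrite prodf_seq_neq0; apply/allP => x xs /=.
rewrite horner_exp hornerXsubC expf_neq0 // subr_eq0.
by apply: contraNneq a_s => ->.
Qed.

(** Powers of distinct linear factors are coprime, so the product always divides the characteristic
    polynomial; [n] factors make the degrees agree, and both sides are monic. The length of the list
    [theta] later supplies the size, in place of the spectral theorem. *)
Lemma prod_eigenvalues (R : rcfType) n (A : 'M[R]_n) :
  size (eigenvalues A) = n ->
  \prod_(x <- eigenvalues A) ('X - x%:P) = char_poly A.
Proof.
move=> szA; have A0 : char_poly A != 0 by rewrite monic_neq0 ?char_poly_monic.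
apply/eqP; rewrite -eqp_monic ?monic_prod_XsubC ?char_poly_monic //.
rewrite -dvdp_size_eqp; first by rewrite size_char_poly size_prod_XsubC szA.
rewrite /eigenvalues big_flatten big_map.
under eq_bigr => x _ do rewrite big_nseq iter_mulr_1.
by apply: dvdp_prod_mup; rewrite ?uniq_roots.
Qed.

(** An injection between index sets of equal size permutes rows and columns alike, so its sign
    enters squared. Separate [m] and [n] allow for sizes that are equal but not convertible, such as
    a cardinal of a sum and a sum of cardinals. *)
Lemma char_poly_reindex (R : comNzRingType) m n (f : 'I_m -> 'I_n)
    (A : 'M[R]_n) :
  m = n -> injective f -> char_poly (mxsub f f A) = char_poly A.
Proof.
move=> mn; case: n / mn in f A *; move=> f_inj.
pose s := perm f_inj.
have -> : char_poly (mxsub f f A)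
    = \det (row_perm s (col_perm s (char_poly_mx A))).
  congr (\det _); apply/matrixP => i j.
  by rewrite !mxE !permE (inj_eq f_inj).
rewrite row_permE col_permE !det_mulmx !det_perm odd_permV.
by rewrite mulrCA -expr2 sqrr_sign mulr1.
Qed.

(** * Determinants of shifted, rank one and block matrices *)

Lemma char_poly_sub_scalar (R : comNzRingType) n (A : 'M[R]_n) (c : R) :
  char_poly (A - c%:M) = char_poly A \Po ('X + c%:P).
Proof.
rewrite /char_poly -[RHS]/(comp_poly _ _) -det_map_mx; congr (\det _).
apply/matrixP => i j; rewrite !mxE [RHS]comp_polyB comp_polyC.
by case: eqP => _; rewrite ?mulr1n ?mulr0n ?comp_polyX ?comp_poly0 polyCB; ring.
Qed.

(* Both sides are [\det] of [[a, u], [v, 1]] up to a factor, computed by the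
   two block eliminations. *)
Lemma det_scalar_sub_rank1 (R : comNzRingType) n (a : R)
    (u : 'cV[R]_n) (v : 'rV[R]_n) :
  a * \det (a%:M - u *m v) = a ^+ n * (a - (v *m u) 0 0).
Proof.
pose K := block_mx a%:M u v (1%:M : 'M_1).
have detL : \det (block_mx (1%:M : 'M[R]_n) 0 (- v) 1%:M) = 1.
  by rewrite det_lblock !det1 mulr1.
have detK : \det K = \det (a%:M - u *m v).
  rewrite -[LHS]mulr1 -detL -det_mulmx mulmx_block.
  by rewrite !mulmx1 !mulmx0 !mul1mx !mulmxN subrr !add0r det_ublock det1 mulr1.
rewrite -detK.
have -> : a * \det K = \det (block_mx 1%:M 0 (- v) a%:M *m K).
  by rewrite det_mulmx det_lblock det1 det_scalar1 mul1r.
rewrite mulmx_block !mul1mx !mul0mx !addr0 !mulNmx mulmx1.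
rewrite scalar_mxC addNr det_ublock det_scalar; congr (_ * _).
by rewrite det_mx11 !mxE /= mulr1n addrC.
Qed.

(** Right multiplication by [[D, 0], [-C, 1]] clears the lower left block. The factor [\det D]
    stays, as it need not be cancellable in [R]. *)
Lemma det_block_comm (R : comNzRingType) n (A B C D : 'M[R]_n) :
  C *m D = D *m C ->
  \det (block_mx A B C D) * \det D = \det (A *m D - B *m C) * \det D.
Proof.
move=> CD; have -> : \det D = \det (block_mx D 0 (- C) 1%:M).
  by rewrite det_lblock det1 mulr1.
rewrite -det_mulmx mulmx_block !mulmx0 !mulmx1 !mulmxN !add0r CD subrr.
by rewrite det_ublock det_lblock det1 mulr1.
Qed.

Lemma char_poly_block_ones (F : idomainType) n (A : 'M[F]_n) (t a : F) :
  let J := const_mx 1 : 'M[F]_n in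
  let q := ('X - t%:P) * ('X - (t - a)%:P) in
  A *m J = t *: J -> J *m A = t *: J ->
  q * char_poly (block_mx A J J (A - a%:M))
    = char_poly A * char_poly (A - a%:M) * (q - n%:R ^+ 2).
Proof.
move=> J q AJ JA.
pose Jp : 'M[{poly F}]_n := const_mx 1.
have charJ (B : 'M[F]_n) b : B *m J = b *: J ->
    char_poly_mx B *m Jp = ('X - b%:P) *: Jp.
  move=> BJ; have -> : Jp = map_mx polyC J by apply/matrixP => i j; rewrite !mxE.
  by rewrite mulmxBl mul_scalar_mx -map_mxM BJ map_mxZ scalerBl.
have Jchar (B : 'M[F]_n) b : J *m B = b *: J ->
    Jp *m char_poly_mx B = ('X - b%:P) *: Jp.
  move=> JB; have -> : Jp = map_mx polyC J by apply/matrixP => i j; rewrite !mxE.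
  by rewrite mulmxBr mul_mx_scalar -map_mxM JB map_mxZ scalerBl.
have BJ : (A - a%:M) *m J = (t - a) *: J.
  by rewrite mulmxBl AJ mul_scalar_mx scalerBl.
have JB : J *m (A - a%:M) = (t - a) *: J.
  by rewrite mulmxBr JA mul_mx_scalar scalerBl.
set B := A - a%:M in BJ JB *.
set M := char_poly_mx A; set N := char_poly_mx B.
have blockE : char_poly_mx (block_mx A J J B) = block_mx M (- Jp) (- Jp) N.
  rewrite /char_poly_mx map_block_mx scalar_mx_block opp_block_mx add_block_mx.
  rewrite !add0r; congr (block_mx _ (- _) (- _) _);
  by apply/matrixP => i j; rewrite !mxE.
have NJ : (- Jp) *m N = N *m (- Jp).
  by rewrite mulNmx mulmxN (Jchar _ _ JB) (charJ _ _ BJ).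
have detN0 : \det N != 0 by rewrite monic_neq0 ?char_poly_monic.
have detE : char_poly (block_mx A J J B) = \det (M *m N - Jp *m Jp).
  apply: (mulIf detN0); rewrite /char_poly blockE det_block_comm //.
  by rewrite mulmxN mulNmx opprK.
have q0 : q != 0 by rewrite mulf_neq0 ?polyXsubC_eq0.
(* The square of J is nJ, written as a column times a row whose product in the other order is
   n^2. *)
pose u : 'cV[{poly F}]_n := const_mx n%:R.
pose v : 'rV[{poly F}]_n := const_mx 1.
have JJ : Jp *m Jp = u *m v.
  apply/matrixP => i j; rewrite !mxE big_ord1 !mxE mulr1.
  under eq_bigr do rewrite !mxE mulr1.
  by rewrite sumr_const card_ord.
have uv : (v *m u) 0 0 = n%:R ^+ 2.
  rewrite !mxE; under eq_bigr do rewrite !mxE mul1r.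
  by rewrite sumr_const card_ord expr2 mulr_natr.
(* On J, N acts as X - (t - a) and M as X - t, so MN acts as the scalar q; this pulls MN out of the
   J^2 term too. *)
have scaledE : q%:M *m (M *m N - Jp *m Jp) = (M *m N) *m (q%:M - u *m v).
  rewrite mulmxBr [RHS]mulmxBr scalar_mxC -JJ; congr (_ - _).
  rewrite mul_scalar_mx [RHS]mulmxA -[in RHS](mulmxA M) (charJ _ _ BJ).
  by rewrite -scalemxAr (charJ _ _ AJ) scalerA mulrC -scalemxAl.
have := congr1 determinant scaledE.
rewrite !det_mulmx det_scalar -detE => {}scaledE.
apply: (mulfI (expf_neq0 n q0)).
have := det_scalar_sub_rank1 _ _ q u v; rewrite uv => rank1.
by rewrite mulrCA scaledE mulrCA rank1 mulrCA.
Qed.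

(** * The Seidel matrices of a regular graph and of its union with the looped copy *)

Lemma seidel_regular (R : rcfType) (G : sgraph) r :
  regular G r ->
  seidel R G *m const_mx 1 = (#|G|%:R - 1 - 2 * r%:R) *: (const_mx 1 : 'M_#|G|).
Proof.
move=> reg_G; apply/matrixP => i k; rewrite !mxE.
under eq_bigr => j _ do rewrite !mxE mulr1.
(* An entry is 1 - [j = i] - 2 [i adjacent to j], also on the diagonal since [adj] is irreflexive;
   the three sums are n, 1 and 2r. *)
transitivity (\sum_j (1 - (j == i)%:R
    - 2 * (adj (enum_val i) (enum_val j))%:R : R)).
  apply: eq_bigr => j _; rewrite eq_sym.
  have [<-|_] := eqVneq; first by rewrite adj_irr /=; ring.
  by case: adj => /=; ring.
rewrite !sumrB -mulr_sumr sumr_const card_ord mulr1; congr (_ - _ - 2 * _).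
  by rewrite (bigD1 i) //= eqxx big1 ?addr0 // => j /negPf ->.
rewrite -natr_sum -(reg_G (enum_val i)); congr _%:R.
rewrite -sum1dep_card [RHS]big_mkcond.
transitivity (\sum_(w in G) adj (enum_val i) w)%N.
  by rewrite [RHS]big_enum_val.
by apply: eq_big => // w _; case: adj.
Qed.

Lemma trmx_seidel (R : rcfType) (G : sgraph) : (seidel R G)^T = seidel R G.
Proof. by apply/matrixP => i j; rewrite !mxE eq_sym adj_sym. Qed.

(** Lists the plain copy first and the looped copy second, which makes the block form of the matrix
    visible. *)
Definition union_index (G : sgraph) (i : 'I_(#|G| + #|G|)) : 'I_#|disjoint_union G G| :=
  enum_rank (match split i with
             | inl j => inl (enum_val j)
             | inr j => inr (enum_val j)
             end : disjoint_union G G).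

Lemma union_index_inj (G : sgraph) : injective (union_index G).
Proof.
move=> i j /enum_rank_inj.
case: (split_ordP i) => i' -> ; case: (split_ordP j) => j' -> //.
  by case=> /enum_val_inj ->.
by case=> /enum_val_inj ->.
Qed.

Lemma union_index_lshift (G : sgraph) (i : 'I_#|G|) :
  enum_val (union_index G (lshift _ i)) = inl (enum_val i).
Proof. by rewrite enum_rankK (unsplitK (inl i)). Qed.

Lemma union_index_rshift (G : sgraph) (i : 'I_#|G|) :
  enum_val (union_index G (rshift _ i)) = inr (enum_val i).
Proof. by rewrite enum_rankK (unsplitK (inr i)). Qed.

Lemma loop_seidel_union_copy (R : rcfType) (G : sgraph) :
  mxsub (union_index G) (union_index G) (loop_seidel R (union_looped_copy G))
  = block_mx (seidel R G) (const_mx 1) (const_mx 1) (seidel R G - 1%:M).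
Proof.
have inl_loops (v : G) : (inl v \in loops (union_looped_copy G)) = false.
  by apply/imsetP => -[].
have inr_loops (v : G) : inr v \in loops (union_looped_copy G).
  exact: imset_f.
apply/matrixP => i j.
case: (split_ordP i) => i' ->; case: (split_ordP j) => j' ->;
  rewrite (block_mxEul, block_mxEur, block_mxEdl, block_mxEdr) !mxE
    (inj_eq (union_index_inj G)) ?(eq_lshift, eq_rshift, eq_lrshift, eq_rlshift)
    ?(union_index_lshift, union_index_rshift) ?inl_loops ?inr_loops /=.
- by rewrite mul0rn subr0.
- by rewrite mul0rn subr0.
- by rewrite mulr0n subr0.
- by [].
Qed.

Lemma card_union_copy (G : sgraph) : #|disjoint_union G G| = (#|G| + #|G|)%N.
Proof. exact: card_sum. Qed.

Lemma char_poly_union_copy (R : rcfType) (G : sgraph) :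
  char_poly (loop_seidel R (union_looped_copy G))
  = char_poly (block_mx (seidel R G) (const_mx 1) (const_mx 1)
                        (seidel R G - 1%:M)).
Proof.
rewrite -loop_seidel_union_copy char_poly_reindex //; last exact: union_index_inj.
by rewrite card_union_copy.
Qed.

Lemma card_loops_union_copy (G : sgraph) : #|loops (union_looped_copy G)| = #|G|.
Proof. by rewrite card_imset //; apply: inr_inj. Qed.

(** * Comparison of the energies *)

(** If |x| >= y, both terms carry the sign of x and y cancels; otherwise their signs differ and x
    cancels. *)
Lemma normrD_normrB_max (R : realDomainType) (x y : R) :
  0 <= y -> `|x + y| + `|x - y| = 2 * Num.max `|x| y.
Proof.
move=> y0; rewrite maxEle.
case: (ger0P x) => hx; case: (ger0P (x + y)) => h1; case: (ger0P (x - y)) => h2;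
  case: ifP => h3; lra.
Qed.

(** Index 1 marks the eigenvalue n - 1 - 2r of the all-ones vector, wherever it stands in the order:
    it is the one that the J blocks affect. *)
Theorem theorem5p1 (R : rcfType) (G : sgraph) (n r : nat) (theta : nat -> R)
  (card_G : #|G| = n) (n_gt0 : (0 < n)%N) (reg_G : regular G r)
  (theta_spec : perm_eq [seq theta i | i <- iota 1 n]
                        (eigenvalues (seidel R G)))
  (theta1 : theta 1%N = n%:R - 1 - 2 * r%:R)
  (theta_ge : forall i : nat, (2 <= i <= n)%N -> 1 / 2 <= `|theta i|) :
  let rho : R := Num.sqrt (n%:R ^+ 2 + 1 / 4) in
  loop_seidel_energy R (union_looped_copy G)
    = 2 * seidel_energy R G
      + 2 * (Num.max `|theta 1%N| rho - `|theta 1%N|)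
  /\ (`|theta 1%N| <= rho ->
      loop_seidel_energy R (union_looped_copy G)
        = 2 * Num.sqrt (n%:R ^+ 2 + 1 / 4)
          + 2 * \sum_(2 <= i < n.+1) `|theta i|).
Proof.
move=> rho; set t := theta 1%N in theta1 *.
have iotaE : iota 1 n = 1%N :: index_iota 2 n.+1.
  by rewrite /index_iota subSS subn1 -{1}(prednK n_gt0).
pose ts := [seq theta i | i <- index_iota 2 n.+1].
have thetaE : [seq theta i | i <- iota 1 n] = t :: ts by rewrite iotaE.
rewrite thetaE in theta_spec.
have ts_ge x : x \in ts -> 1 / 2 <= `|x|.
  by case/mapP => i; rewrite mem_index_iota => /theta_ge ? ->.
have sum_ts : \sum_(2 <= i < n.+1) `|theta i| = \sum_(x <- ts) `|x|.
  by rewrite big_map.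
have size_ts : size (t :: ts) = n by rewrite -thetaE size_map size_iota.
clearbody ts.
have charS : char_poly (seidel R G) = \prod_(x <- t :: ts) ('X - x%:P).
  rewrite -prod_eigenvalues -?(perm_big _ theta_spec) //.
  by rewrite -(perm_size theta_spec) size_ts.
have charS1 : char_poly (seidel R G - 1%:M)
    = \prod_(x <- t :: ts) ('X - (x - 1)%:P).
  rewrite char_poly_sub_scalar charS rmorph_prod; apply: eq_bigr => x _ /=.
  by rewrite comp_polyB comp_polyX comp_polyC polyCB; ring.
have rho_ge0 : 0 <= rho by exact: sqrtr_ge0.
have rho2 : rho ^+ 2 = n%:R ^+ 2 + 1 / 4.
  by rewrite sqr_sqrtr // addr_ge0 ?exprn_ge0 // divr_ge0.
have SJ : seidel R G *m const_mx 1 = t *: (const_mx 1 : 'M_#|G|).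
  by rewrite (seidel_regular _ _ _ reg_G) theta1 card_G.
have JS : const_mx 1 *m seidel R G = t *: (const_mx 1 : 'M_#|G|).
  rewrite -[LHS]trmxK trmx_mul trmx_seidel trmx_const SJ.
  by rewrite linearZ /= trmx_const.
have charU : char_poly (loop_seidel R (union_looped_copy G))
    = \prod_(x <- [:: t - 1 / 2 + rho, t - 1 / 2 - rho
                    & ts ++ [seq x - 1 | x <- ts]]) ('X - x%:P).
  rewrite char_poly_union_copy.
  apply: (@mulfI _ (('X - t%:P) * ('X - (t - 1)%:P))).
    by rewrite mulf_neq0 ?polyXsubC_eq0.
  rewrite char_poly_block_ones // charS charS1 !big_cons big_cat big_map /= card_G.
  (* Completing the square: the left side is (X - t + 1/2)^2 - (n^2 + 1/4). *)
  have -> : ('X - t%:P) * ('X - (t - 1)%:P) - n%:R ^+ 2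
      = ('X - (t - 1 / 2 + rho)%:P) * ('X - (t - 1 / 2 - rho)%:P).
    have two_h : 1 = (1 / 2)%:P + (1 / 2)%:P :> {poly R}.
      by rewrite -polyCD -polyC1; congr _%:P; field.
    have rho2P : rho%:P ^+ 2 = n%:R ^+ 2 + (1 / 2)%:P ^+ 2 :> {poly R}.
      have quarter : 1 / 4 = (1 / 2) ^+ 2 :> R by field.
      by rewrite -polyC_exp rho2 quarter polyCD !polyC_exp polyC_natr.
    rewrite !(polyCD, polyCB, polyCN) polyC1 [X in t%:P - X]two_h.
    (* The half becomes an opaque [h]: 1 is already rewritten as h + h, and rho^2 = n^2 + h^2 is the
       only relation left to use. *)
    move: (1 / 2)%:P two_h rho2P => h two_h rho2P.
    by ring: rho2P.
  by ring.
have energyG : seidel_energy R G = `|t| + \sum_(x <- ts) `|x|.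
  by rewrite /seidel_energy -(perm_big _ theta_spec) big_cons.
have energyU : loop_seidel_energy R (union_looped_copy G)
    = 2 * Num.max `|t| rho + 2 * \sum_(x <- ts) `|x|.
  rewrite /loop_seidel_energy (perm_big _ (eigenvalues_split charU)).
  rewrite card_loops_union_copy card_union_copy card_G.
  (* Half of the vertices carry loops, so the energy shifts the spectrum by 1/2. *)
  have -> : n%:R / (n + n)%:R = 1 / 2 :> R.
    have n_neq0 : n%:R != 0 :> R by rewrite pnatr_eq0 -lt0n.
    by rewrite addnn -muln2 natrM; field.
  rewrite !big_cons big_cat big_map /= -big_split /= addrA; congr (_ + _).
    by rewrite -normrD_normrB_max //; congr (`|_ : R| + `|_ : R|); field.
  rewrite mulr_sumr; apply: eq_big_seq => x /ts_ge.
  case: (ger0P x) => hx; case: (ger0P (x + 1 / 2)) => h1;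
    case: (ger0P (x - 1 + 1 / 2)) => h2 h3; lra.
rewrite energyG energyU sum_ts; split; first by ring.
by move=> t_le; rewrite (max_idPr t_le).
Qed.
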